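(* For every even positive integer $n$ there is a quantum protocol using $\lceil\log_2 n\rceil$ qubits that solves $\mathrm{HM}_n$ with zero error and is parity-oblivious. That is, with $q=\lceil\log_2 n\rceil$, there exist density operators $\rho_x$ on $(\mathbb C^2)^{\otimes q}$ for $x\in\{0,1\}^n$ and, for every perfect matching $\mathtt M$ of $[n]$, a POVM $\{E^{\mathtt M}_{(e,b)}\}$ indexed by $e\in\mathtt M$, $b\in\{0,1\}$, such that: (i) for all $x\in\{0,1\}^n$, all perfect matchings $\mathtt M$, all $e=\{i,j\}\in\mathtt M$ and $b\in\{0,1\}$ with $b\ne x_i\oplus x_j$, one has $\operatorname{Tr}(\rho_xE^{\mathtt M}_{(e,b)})=0$; (ii) for every $S\in\mathcal F_n$ and every POVM $\{E_k\}_k$ on $(\mathbb C^2)^{\otimes q}$, the outcome statistics are independent of $x_S$: $\operatorname{Tr}(\rho_{S,0}E_k)=\operatorname{Tr}(\rho_{S,1}E_k)$ for all $k$, where $\rho_{S,b}:=2^{-(n-1)}\sum_{x:\,x_S=b}\rho_x$.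
   Context: $[n]=\{1,\dots,n\}$; for $x\in\{0,1\}^n$ and $S\subseteq[n]$, $x_S=\bigoplus_{i\in S}x_i$; $\mathcal F_n=\{S\subseteq[n]:|S|\neq0,2\}$. A perfect matching of $[n]$ is a set of $n/2$ pairwise disjoint two-element subsets of $[n]$ with union $[n]$. In the Hidden Matching task $\mathrm{HM}_n$, Alice holds $x\in\{0,1\}^n$ and sends one message (here a $q$-qubit state $\rho_x$) to Bob, who holds a perfect matching $\mathtt M$ and must output an edge $\{i,j\}\in\mathtt M$ with a bit $b$; the output is correct if $b=x_i\oplus x_j$. A POVM is a family of positive semidefinite operators summing to the identity. *)

(* Defs.v *)
From mathcomp Require Export all_boot all_order all_algebra.
From mathcomp Require Export reals complex.

Set Implicit Arguments.
Unset Strict Implicit.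
Unset Printing Implicit Defensive.

Import Order.TTheory GRing.Theory Num.Theory.
Local Open Scope ring_scope.
Local Open Scope sesquilinear_scope.

(* [n] is rendered as 'I_n, {0,1}^n as {ffun 'I_n -> bool}, and addition modulo 2
   as addb. *)

Definition parity (n : nat) (x : {ffun 'I_n -> bool}) (S : {set 'I_n}) : bool :=
  \big[addb/false]_(i in S) x i.

Definition parity_sets (n : nat) : {set {set 'I_n}} :=
  [set S : {set 'I_n} | (#|S| != 0)%N && (#|S| != 2)%N].

Definition perfect_matching (n : nat) (M : {set {set 'I_n}}) : Prop :=
  [/\ #|M| = n./2,
      forall e, e \in M -> #|e| = 2,
      trivIset M
    & cover M = [set: 'I_n]].

(* Operators on a q-qubit space are matrices of size 2 ^ q, in the computational
   basis.  In a numClosedFieldType, 0 <= z says that z is real and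
   nonnegative. *)
Definition psdmx (C : numClosedFieldType) (d : nat) (A : 'M[C]_d) : Prop :=
  A \is hermsymmx /\ forall v : 'cV[C]_d, 0 <= (v ^t* *m A *m v) 0 0.

Definition density (C : numClosedFieldType) (d : nat) (A : 'M[C]_d) : Prop :=
  psdmx A /\ \tr A = 1.

Definition povm (C : numClosedFieldType) (d : nat) (K : finType)
    (E : K -> 'M[C]_d) : Prop :=
  (forall k, psdmx (E k)) /\ \sum_k E k = 1%:M.

(* rho_{S,b}, the uniform mixture of the rho_x with x_S = b; exactly 2 ^ (n - 1)
   strings x satisfy x_S = b when S is nonempty. *)
Definition parity_state (C : numClosedFieldType) (n d : nat)
    (rho : {ffun 'I_n -> bool} -> 'M[C]_d) (S : {set 'I_n}) (b : bool) :
    'M[C]_d :=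
  (2 ^+ n.-1)^-1 *: \sum_(x : {ffun 'I_n -> bool} | parity x S == b) rho x.

(* Main.v *)
(* rho_x is the pure state n^(-1/2) * sum_i (-1)^(x_i) |i>.  Bob measures the
   edge ij in the vectors (|i> + (-1)^b |j>) / sqrt 2; the one with
   b <> x_i + x_j is orthogonal to the state.  The (i, j) entry of
   rho_(S,0) - rho_(S,1) is proportional to the sum over x of
   (-1)^(x_S + x_i + x_j), which vanishes unless S is the symmetric difference
   of {i} and {j}, a set of size 0 or 2. *)
Require Import Defs.
From mathcomp Require Import ring.

Set Implicit Arguments.
Unset Strict Implicit.
Unset Printing Implicit Defensive.

Import Order.TTheory GRing.Theory Num.Theory.
Local Open Scope ring_scope.
Local Open Scope sesquilinear_scope.

(** * Adjoints, positive semidefinite operators and rank-one operators *)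

Section Operators.
Variables (C : numClosedFieldType) (d : nat).

Lemma adjmx_mul k m p (A : 'M[C]_(k, m)) (B : 'M[C]_(m, p)) :
  (A *m B) ^t* = B ^t* *m A ^t*.
Proof. by rewrite trmx_mul map_mxM. Qed.

Lemma adjmx_sum (I : Type) (r : seq I) (P : pred I) m p (F : I -> 'M[C]_(m, p)) :
  (\sum_(i <- r | P i) F i) ^t* = \sum_(i <- r | P i) (F i) ^t*.
Proof. by rewrite raddf_sum raddf_sum. Qed.

Lemma adjmx_sign m p (b : bool) (A : 'M[C]_(m, p)) :
  ((-1) ^+ b *: A) ^t* = (-1) ^+ b *: A ^t*.
Proof. by rewrite linearZ /= map_mxZ rmorphXn rmorphN1. Qed.

Definition ketbra (v : 'cV[C]_d) : 'M[C]_d := v *m v ^t*.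

Lemma psdmxD (A B : 'M[C]_d) : psdmx A -> psdmx B -> psdmx (A + B).
Proof.
move=> [/is_hermitianmxP hA pA] [/is_hermitianmxP hB pB]; split=> [|v].
  by apply/is_hermitianmxP; rewrite raddfD /= map_mxD scalerDr -hA -hB.
by rewrite mulmxDr mulmxDl mxE addr_ge0.
Qed.

Lemma psdmxZ (a : C) (A : 'M[C]_d) : 0 <= a -> psdmx A -> psdmx (a *: A).
Proof.
move=> a_ge0 [/is_hermitianmxP hA pA]; split=> [|v].
  apply/is_hermitianmxP; rewrite linearZ /= map_mxZ /= conj_Creal ?ger0_real //.
  by rewrite scalerA mulrC -scalerA -hA.
by rewrite -scalemxAr -scalemxAl mxE mulr_ge0.
Qed.

Lemma psdmx_ketbra (v : 'cV[C]_d) : psdmx (ketbra v).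
Proof.
split=> [|w].
  by apply/is_hermitianmxP; rewrite scale1r adjmx_mul trmxCK.
rewrite mulmxA -mulmxA -[w ^t* *m v]trmxCK adjmx_mul trmxCK mxE big_ord1 !mxE.
by rewrite mulrC mul_conjC_ge0.
Qed.

Lemma psdmx0 : psdmx (0 : 'M[C]_d).
Proof.
split=> [|v]; last by rewrite mulmx0 mul0mx mxE.
by apply/is_hermitianmxP; rewrite scale1r trmx0 map_mx0.
Qed.

Lemma psdmx_sum (I : Type) (r : seq I) (P : pred I) (F : I -> 'M[C]_d) :
  (forall i, P i -> psdmx (F i)) -> psdmx (\sum_(i <- r | P i) F i).
Proof.
by move=> psdF; elim/big_ind: _ => //; [exact: psdmx0 | exact: psdmxD].
Qed.

Lemma ketbra_orthogonal (v w : 'cV[C]_d) :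
  v ^t* *m w = 0 -> ketbra v *m ketbra w = 0.
Proof. by move=> vw0; rewrite /ketbra mulmxA -(mulmxA v) vw0 mulmx0 mul0mx. Qed.

(** The cross terms cancel. For the basis kets of the two endpoints of an edge, the right side is
    twice the projector onto their span. *)
Lemma ketbra_sum_sub (v w : 'cV[C]_d) :
  ketbra (v + w) + ketbra (v - w) = 2 *: (ketbra v + ketbra w).
Proof.
apply/matrixP => i j; rewrite !mxE !big_ord1 !mxE rmorphD rmorphB.
by ring.
Qed.

End Operators.

(** * The phase states, the edge measurements and obliviousness *)

Section Protocol.
Variables (C : numClosedFieldType) (n d : nat) (le_nd : (n <= d)%N).
Implicit Types (x : {ffun 'I_n -> bool}) (e S : {set 'I_n}).

(** A power of two may exceed [n], so [[n]] is embedded as the first [n] basis vectors. *)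
Definition basis_ket (i : 'I_n) : 'cV[C]_d := delta_mx (widen_ord le_nd i) 0.

Lemma basis_ket_dot i j : (basis_ket i) ^t* *m basis_ket j = (i == j)%:R%:M.
Proof.
rewrite trmx_delta map_delta_mx; have [->|ij] := eqVneq i j.
  by rewrite mul_delta_mx; apply/matrixP => k l; rewrite !ord1 !mxE.
by rewrite mul_delta_mx_0 // raddf0.
Qed.

(** Left unnormalised, with squared norm [n]; the factor [n%:R^-1] of [phase_state] compensates, so
    square roots are avoided. *)
Definition phase_ket x : 'cV[C]_d := \sum_i (-1) ^+ x i *: basis_ket i.

Lemma phase_ket_dot x i : (phase_ket x) ^t* *m basis_ket i = ((-1) ^+ x i)%:M.
Proof.
rewrite adjmx_sum mulmx_suml (bigD1 i) //= big1 => [|j ji].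
  by rewrite addr0 adjmx_sign -scalemxAl basis_ket_dot eqxx scale_scalar_mx mulr1.
by rewrite adjmx_sign -scalemxAl basis_ket_dot (negPf ji) raddf0 scaler0.
Qed.

(* The sign sits on an arbitrary endpoint of e; moving it to the other one
   changes the vector by a global sign only. *)
Definition edge_ket e (b : bool) : 'cV[C]_d :=
  \sum_(i in e) (-1) ^+ (b && (Some i == [pick j in e])) *: basis_ket i.

Lemma edge_ketE e : #|e| = 2 ->
  exists i j, [/\ i != j, e = [set i; j]
    & forall b : bool, edge_ket e b = basis_ket i + (-1) ^+ b *: basis_ket j].
Proof.
move=> e2; rewrite /edge_ket; case: pickP => [j je|e0]; last first.
  by move: e2; rewrite (eq_card0 e0).
(* [j] is the picked endpoint, which carries the sign; [i] is what remains of [e]. *)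
have /cards1P[i ei] : #|e :\ j| == 1%N by apply/eqP; move: e2; rewrite (cardsD1 j) je => -[].
have ij : i != j by have := set11 i; rewrite -ei !inE => /andP[].
exists i, j; have eE : e = [set i; j] by rewrite -(setD1K je) ei setUC.
split=> // b; rewrite {1}eE big_setU1 ?inE //= big_set1.
by rewrite /eq_op /= eqxx (negPf ij) andbT andbF expr0 scale1r.
Qed.

Lemma parity_pair x i j : i != j -> parity x [set i; j] = x i (+) x j.
Proof. by move=> ij; rewrite /parity big_setU1 ?inE //= big_set1. Qed.

Lemma phase_edge_dot x e b : #|e| = 2 -> b != parity x e ->
  (phase_ket x) ^t* *m edge_ket e b = 0.
Proof.
move=> /edge_ketE[i [j [ij -> ->]]]; rewrite parity_pair //.
(* The product is the sum of the signs with exponents [x i] and [b (+) x j], which are opposite by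
   the choice of [b]. *)
rewrite mulmxDr -scalemxAr !phase_ket_dot.
case: b (x i) (x j) => [] [] [] //= _;
  by rewrite ?(expr0, expr1, scale1r, scaleN1r) -?raddfN -raddfD ?opprK
             ?subrr ?addNr raddf0.
Qed.

Definition outside_proj : 'M[C]_d :=
  \sum_(k < d | (n <= k)%N) ketbra (delta_mx k 0).

Lemma basis_completeness : \sum_i ketbra (basis_ket i) + outside_proj = 1%:M.
Proof.
rewrite mx1_sum_delta (bigID (fun k : 'I_d => (k < n)%N)) /= big_ord_narrow.
congr (_ + _); last apply: eq_big => [k|k _]; rewrite -?leqNgt //.
  by apply: eq_bigr => i _; rewrite /ketbra trmx_delta map_delta_mx mul_delta_mx.
by rewrite /ketbra trmx_delta map_delta_mx mul_delta_mx.
Qed.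

Lemma phase_outside x : (phase_ket x) ^t* *m outside_proj = 0.
Proof.
rewrite adjmx_sum mulmx_suml big1 // => i _; rewrite adjmx_sign -scalemxAl.
rewrite mulmx_sumr big1 ?scaler0 // => k le_nk.
rewrite mulmxA trmx_delta map_delta_mx mul_delta_mx_0 ?mul0mx //.
by rewrite -val_eqE neq_ltn (leq_trans (ltn_ord i)).
Qed.

Definition phase_state x : 'M[C]_d := n%:R^-1 *: ketbra (phase_ket x).

Lemma phase_state_density x : (0 < n)%N -> density (phase_state x).
Proof.
move=> n_gt0; split.
  by apply: psdmxZ; [rewrite invr_ge0 ler0n | exact: psdmx_ketbra].
(* Cyclicity turns the trace into the squared norm of [phase_ket x], a sum of [n] ones. *)
rewrite /phase_state linearZ /= mxtrace_mulC {2}/phase_ket mulmx_sumr.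
rewrite (eq_bigr (fun=> 1%:M)) => [|i _]; last first.
  by rewrite -scalemxAr phase_ket_dot scale_scalar_mx -expr2 sqrr_sign.
by rewrite raddf_sum /= mxtrace1 sumr_const card_ord mulVf // pnatr_eq0 -lt0n.
Qed.

(* The basis vectors beyond n never occur in a state; their projector is shared
   equally among the n outcomes to complete the POVM. *)
Definition edge_effect e b : 'M[C]_d :=
  2^-1 *: ketbra (edge_ket e b) + n%:R^-1 *: outside_proj.

Lemma edge_effect_psd e b : psdmx (edge_effect e b).
Proof.
apply: psdmxD; apply: psdmxZ; rewrite ?invr_ge0 ?ler0n //.
  exact: psdmx_ketbra.
by apply: psdmx_sum => k _; exact: psdmx_ketbra.
Qed.

Lemma edge_effect_povm M : (0 < n)%N -> ~~ odd n -> perfect_matching M ->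
  povm (fun o : {e | e \in M} * bool => edge_effect (val o.1) o.2).
Proof.
move=> n_gt0 n_even [cM edges trivM covM]; split=> [[e b]|].
  exact: edge_effect_psd.
rewrite big_split /= sumr_const -scaler_sumr card_prod card_sig card_bool.
rewrite -[RHS]basis_completeness; congr (_ + _).
  rewrite -(pair_big xpredT xpredT
    (fun (e : {e | e \in M}) b => ketbra (edge_ket (val e) b))) /=.
  rewrite -(big_sub (mem M) (fun e => \sum_b ketbra (edge_ket e b))).
  (* The two outcomes of an edge together give twice the projector onto its span; the factor [2^-1]
     absorbs the 2, and the edges of [M] partition [[n]]. *)
  rewrite (eq_bigr (fun e => 2 *: \sum_(i in e) ketbra (basis_ket i))); last first.
    move=> e /edges /edge_ketE[i [j [ij -> ketE]]].
    rewrite big_setU1 ?inE //= big_set1 big_bool !ketE expr0 expr1 scale1r scaleN1r.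
    by rewrite -ketbra_sum_sub; exact: addrC.
  rewrite -scaler_sumr scalerA mulVf ?pnatr_eq0 // scale1r.
  rewrite -(big_trivIset _ trivM) covM.
  by apply: eq_bigl => i; rewrite inE.
(* By evenness, [n./2] edges with two bits each make exactly [n] outcomes, matching the share
   [n%:R^-1]. *)
rewrite -scaler_nat scalerA; have -> : (#|[pred e in M]| * 2 = n)%N.
  by rewrite cM muln2 even_halfK.
by rewrite mulfV ?scale1r // pnatr_eq0 -lt0n.
Qed.

Lemma phase_edge_trace x e b : #|e| = 2 -> b != parity x e ->
  \tr (phase_state x *m edge_effect e b) = 0.
Proof.
move=> e2 bP; rewrite mulmxDr -!scalemxAl -!scalemxAr.
rewrite (ketbra_orthogonal (phase_edge_dot e2 bP)) -(mulmxA (phase_ket x)).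
by rewrite phase_outside mulmx0 !scaler0 addr0 mxtrace0.
Qed.

(** The exponent is the parity of [x] on the symmetric difference of [S], [{i}] and [{j}]. Flipping
    a coordinate [t] of that set is an involution on strings that negates every term. *)
Lemma character_sum (S : {set 'I_n}) i j : S \in parity_sets n ->
  \sum_x (-1) ^+ (parity x S (+) (x i (+) x j)) = 0 :> C.
Proof.
rewrite inE => /andP[S0 S2].
have [t tP] : exists t, (t \in S) (+) ((t == i) (+) (t == j)).
  (* Without such a [t], [S] would be empty (if [i = j]) or the pair [[set i; j]]. *)
  apply/existsP; apply: contraT; rewrite negb_exists => /forallP nt.
  have SE t : (t \in S) = (t == i) (+) (t == j).
    by have := nt t; rewrite negb_add => /eqP.
  have [ij|ij] := eqVneq i j.
    have : S = set0 by apply/setP => t; rewrite SE ij addbb inE.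
    by move=> SE0; rewrite SE0 cards0 in S0.
  have SE2 : S = [set i; j].
    apply/setP => t; rewrite SE !inE; case: (eqVneq t i) => //= ->.
    by rewrite (negPf ij).
  by rewrite SE2 cards2 ij in S2.
pose flip x := [ffun k => x k (+) (k == t)].
have flipK : involutive flip.
  by move=> x; apply/ffunP => k; rewrite !ffunE -addbA addbb addbF.
set s := LHS; suff sN : s = - s.
  have : s *+ 2 == 0 by rewrite mulr2n {1}sN addNr.
  by rewrite mulrn_eq0 => /eqP.
rewrite {1}/s (reindex_inj (inv_inj flipK)) /= -sumrN; apply: eq_bigr => x _.
have -> : parity (flip x) S = parity x S (+) (t \in S).
  rewrite /parity (eq_bigr (fun k => x k (+) (k == t))) => [|k _]; last first.
    by rewrite ffunE.
  rewrite big_split /=; congr (_ (+) _); case: (boolP (t \in S)) => tS.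
    by rewrite (bigD1 t) //= eqxx big1 // => k /andP[_ /negPf].
  by rewrite big1 // => k kS; apply/negP => /eqP kt; rewrite -kt kS in tS.
rewrite !ffunE -signrN.
congr (_ ^+ nat_of_bool _).
(* The flip changes the exponent by [(t \in S) (+) (i == t) (+) (j == t)], which is true by [tP]. *)
move: tP; rewrite (eq_sym t i) (eq_sym t j).
by case: (parity x S) (t \in S) (x i) (x j) (i == t) (j == t)
  => [] [] [] [] [] [].
Qed.

(** Equality holds between the operators themselves, so every measurement has the same statistics on
    both. *)
Lemma phase_parity_state (S : {set 'I_n}) : S \in parity_sets n ->
  parity_state phase_state S false = parity_state phase_state S true.
Proof.
move=> SP; congr (_ *: _); apply/eqP; rewrite -subr_eq0; apply/eqP.
transitivity (\sum_x (-1) ^+ parity x S *: phase_state x).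
  rewrite [RHS](bigID (fun x => parity x S == false)) /= -sumrN; congr (_ + _).
    by apply: eq_bigr => x /eqP->; rewrite scale1r.
  apply: eq_big => [x|x /eqP->]; first by case: (parity x S).
  by rewrite scaleN1r.
have ketbraE x : ketbra (phase_ket x) =
    \sum_i \sum_j (-1) ^+ (x i (+) x j) *: (basis_ket i *m (basis_ket j) ^t*).
  rewrite /ketbra adjmx_sum mulmx_suml; apply: eq_bigr => i _.
  rewrite mulmx_sumr; apply: eq_bigr => j _.
  by rewrite adjmx_sign -scalemxAl -scalemxAr scalerA signr_addb.
under eq_bigr => x _.
  rewrite /phase_state scalerA mulrC -scalerA ketbraE scaler_sumr.
  under eq_bigr => i _.
    rewrite scaler_sumr.
    under eq_bigr do rewrite scalerA -signr_addb.
    over.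
  over.
(* With the sum over [x] innermost, the coefficient of each matrix unit is a character sum. *)
rewrite /= -scaler_sumr exchange_big big1 ?scaler0 //= => i _.
rewrite exchange_big big1 //= => j _.
by rewrite -scaler_suml character_sum // scale0r.
Qed.

End Protocol.

(* up_log 2 n is the least q with n <= 2 ^ q, i.e. the ceiling of log_2 n. *)
Theorem theorem3 (R : realType) (n : nat) (n_gt0 : (0 < n)%N)
    (n_even : ~~ odd n) :
  let q := up_log 2 n in
  exists (rho : {ffun 'I_n -> bool} -> 'M[R[i]]_(2 ^ q)%N)
         (E : forall M : {set {set 'I_n}},
                {e : {set 'I_n} | e \in M} * bool -> 'M[R[i]]_(2 ^ q)%N),
    [/\ forall x : {ffun 'I_n -> bool}, density (rho x),
        forall M : {set {set 'I_n}}, perfect_matching M -> povm (E M),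
        forall (x : {ffun 'I_n -> bool}) (M : {set {set 'I_n}}),
          perfect_matching M ->
          forall (e : {e : {set 'I_n} | e \in M}) (i j : 'I_n) (b : bool),
            val e = [set i; j] -> b != x i (+) x j ->
            \tr (rho x *m E M (e, b)) = 0
      & forall S : {set 'I_n}, S \in parity_sets n ->
          forall (K : finType) (F : K -> 'M[R[i]]_(2 ^ q)%N), povm F ->
            forall k : K,
              \tr (parity_state rho S false *m F k) =
              \tr (parity_state rho S true *m F k)].
Proof.
move=> q; have le_n : (n <= 2 ^ q)%N by exact: up_logP.
exists (phase_state _ le_n).
exists (fun M o => edge_effect _ le_n (val o.1) o.2); split.
- by move=> x; exact: phase_state_density.
- by move=> M; exact: edge_effect_povm.
- move=> x M [_ edges _ _] e i j b eE bx.
  (* An edge has two elements, which forces [i != j], as [parity_pair] requires. *)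
  have e2 := edges _ (valP e); apply: phase_edge_trace => //.
  rewrite eE parity_pair //; move: e2; rewrite eE cards2.
  by case: (i != j).
- by move=> S SP K F _ k; rewrite phase_parity_state.
Qed.
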